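(* Let $S,W,K$ be integers with $0\le K<W\le S$. For every $(S,N,W,K)$ binary constant-weight code, the number $N$ of codewords satisfies $$N\le\left\lfloor\frac{S}{W}\left\lfloor\frac{S-1}{W-1}\left\lfloor\cdots\left\lfloor\frac{S-K}{W-K}\right\rfloor\cdots\right\rfloor\right\rfloor\right\rfloor ,$$ where the nested floors run over the $K+1$ fractions $\frac{S-r}{W-r}$, $r=0,1,\dots,K$, with $r=0$ outermost and $r=K$ innermost.
   Context: An $(S,N,W,K)$ binary constant-weight code (CWC) is a set of $N$ distinct codewords $x_1,\dots,x_N\in\{0,1\}^S$, $x_j=(x_{j,0},\dots,x_{j,S-1})$, each of Hamming weight exactly $W$, such that for all $j\ne j'$ the number of overlapping ones satisfies $\gamma_{j,j'}:=\sum_{s=0}^{S-1}x_{j,s}x_{j',s}\le K$. *)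

(* Defs.v *)
From mathcomp Require Import all_boot all_order all_algebra.

Set Implicit Arguments.
Unset Strict Implicit.
Unset Printing Implicit Defensive.

Import Order.TTheory GRing.Theory Num.Theory.

Definition codeword (S : nat) := {ffun 'I_S -> bool}.

(* The bits of a codeword are summed as the naturals 0 and 1, through the
   coercion [nat_of_bool]. *)
Definition hamming_weight (S : nat) (x : codeword S) : nat :=
  \sum_(s < S) x s.

Definition overlap (S : nat) (x y : codeword S) : nat :=
  \sum_(s < S) x s * y s.

Definition is_cwc (S N W K : nat) (C : {set codeword S}) : Prop :=
  [/\ #|C| = N,
      forall x, x \in C -> hamming_weight x = W
    & forall x y, x \in C -> y \in C -> x != y -> overlap x y <= K].

Local Open Scope ring_scope.

(* [foldr] over [:: 0; ...; K] puts r = 0 outermost and r = K innermost; the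
   seed 1 makes the innermost term the floor of (S - K) / (W - K).  The
   subtractions and divisions are those of [rat], so nothing is truncated. *)
Definition nested_floor (S W K : nat) : int :=
  foldr (fun (r : nat) (t : int) =>
           Num.floor ((S%:R - r%:R) / (W%:R - r%:R) * t%:~R : rat))
        1 (iota 0 K.+1).

(* Main.v *)
(* For a set F of r coordinates, let C_F be the set of codewords that are 1 on F.
   Two distinct codewords never share K + 1 ones, so #|C_F| <= 1 when r = K + 1.
   For r <= K, counting the pairs (x, s) with x in C_F, s outside F and x_s = 1
   gives (W - r) #|C_F| = \sum_(s notin F) #|C_(F + s)|, so a bound t on the
   terms gives #|C_F| <= floor ((S - r) / (W - r) * t). Descend to F = set0. *)
Require Import Defs.
From mathcomp Require Import all_boot all_order all_algebra.

Import Order.TTheory GRing.Theory Num.Theory.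

(** The truncated [W - #|F|] is harmless: any member of [C] containing [F] forces [#|F| <= W], and
    without such a member both sides vanish. *)
Lemma double_count_extensions (T : finType) (W : nat) (C : {set {set T}})
    (F : {set T}) :
  (forall A, A \in C -> #|A| = W) ->
  \sum_(s in ~: F) #|[set A in C | s |: F \subset A]| =
  #|[set A in C | F \subset A]| * (W - #|F|).
Proof.
move=> hW; rewrite -sum_nat_const.
have -> : \sum_(A in [set A in C | F \subset A]) (W - #|F|) =
          \sum_(A in [set A in C | F \subset A]) \sum_(s in ~: F) (s \in A).
  apply: eq_bigr => A; rewrite inE => /andP[AC FA].
  rewrite -(hW A AC) -big_mkcondr /= sum1_card.
  have -> : #|A| - #|F| = #|A :\: F| by rewrite cardsD (setIidPr FA).
  by apply: eq_card => s; rewrite inE [RHS]unfold_in inE.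
rewrite exchange_big; apply: eq_bigr => s _.
rewrite -big_mkcondr /= sum1_card; apply: eq_card => A.
by rewrite [RHS]unfold_in !inE subUset sub1set andbA andbAC.
Qed.

(** Induction on [n], the number of coordinates still to be added to [F], with [F] general so that
    it can grow to [s |: F]. The [foldr] is the inner part of the nested floor from level [#|F|]
    on. *)
Lemma card_extensions_le (T : finType) (W K n : nat) (C : {set {set T}})
    (F : {set T}) :
  (K < W)%N -> (forall A, A \in C -> #|A| = W) ->
  (forall A B, A \in C -> B \in C -> A != B -> (#|A :&: B| <= K)%N) ->
  (#|F| + n)%N = K.+1 ->
  (#|[set A in C | F \subset A]|%:Z <=
   foldr (fun (r : nat) (t : int) =>
            Num.floor ((#|T|%:R - r%:R) / (W%:R - r%:R) * t%:~R : rat))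
         1 (iota #|F| n))%R.
Proof.
move=> hKW hW hK; elim: n F => [|n IHn] F hF.
  rewrite lez_nat; apply/card_le1_eqP => A B; rewrite !inE.
  move=> /andP[AC FA] /andP[BC FB]; apply/eqP/negPn/negP => neqBA.
  have : #|F| <= #|A :&: B| by rewrite subset_leq_card // subsetI FA FB.
  by rewrite -(addn0 #|F|) hF setIC leqNgt ltnS hK.
rewrite /=; set t := foldr _ _ _.
have ltFW : #|F| < W.
  by apply: leq_trans hKW; rewrite -hF addnS ltnS leq_addr.
have WF0 : (0 < W%:R - #|F|%:R :> rat)%R by rewrite subr_gt0 ltr_nat.
rewrite floor_ge_int mulrAC ler_pdivlMr // -natrB ?(ltnW ltFW) //.
rewrite pmulrn -natrM -double_count_extensions // natr_sum.
(* [#|T| - #|F|] counts the [s] outside [F], so the right side is a sum of copies of [t], compared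
   term by term. *)
rewrite -natrB ?max_card // -(cardsC F) addKn mulr_natl -sumr_const.
apply: ler_sum => s; rewrite inE => sF.
have cF : #|s |: F| = #|F|.+1 by rewrite cardsU1 sF.
by rewrite pmulrn ler_int /t -cF; apply: IHn; rewrite cF -hF addnS.
Qed.

(** Carries codewords to sets, where overlaps become intersections. *)
Definition support {S : nat} (x : codeword S) : {set 'I_S} := [set s | x s].

Lemma support_inj (S : nat) : injective (@support S).
Proof.
by move=> x y /setP xy; apply/ffunP => s; have := xy s; rewrite !inE.
Qed.

Lemma card_support (S : nat) (x : codeword S) : #|support x| = hamming_weight x.
Proof.
by rewrite /hamming_weight -sum1_card big_mkcond; apply: eq_bigr => s _;
  rewrite inE; case: (x s).
Qed.

Lemma card_supportI (S : nat) (x y : codeword S) :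
  #|support x :&: support y| = overlap x y.
Proof.
by rewrite /overlap -sum1_card big_mkcond; apply: eq_bigr => s _;
  rewrite !inE; case: (x s); case: (y s).
Qed.

Theorem theorem2 (S N W K : nat) (hKW : K < W) (hWS : W <= S)
  (C : {set codeword S}) (hC : is_cwc N W K C) :
  (N%:Z <= nested_floor S W K)%R.
Proof.
case: hC => hN hW hK.
have := @card_extensions_le _ W K K.+1 (support @: C) set0 hKW.
rewrite cards0 card_ord.
have -> : [set A in support @: C | set0 \subset A] = support @: C.
  by apply/setP => A; rewrite !inE sub0set andbT.
rewrite card_imset; last exact: support_inj.
rewrite hN; apply => //.
  by move=> _ /imsetP[x xC ->]; rewrite card_support hW.
move=> _ _ /imsetP[x xC ->] /imsetP[y yC ->] xy.
by rewrite card_supportI hK //; apply: contraNneq xy => ->.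
Qed.
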